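(* An abstract basis exchange graph determines its matroid $M$ up to (1) the isomorphism type of $M$, (2) duality of the connected components of $M$, and (3) possible loops and coloops. That is: let $M$ and $M'$ be matroids whose basis exchange graphs $G(M)$ and $G(M')$ are isomorphic as (unlabelled) graphs. Let $M_1,\dots,M_k$ be the connected direct summands of the matroid obtained from $M$ by removing all loops and coloops, and let $M'_1,\dots,M'_{k'}$ be the connected direct summands of the matroid obtained from $M'$ by removing all loops and coloops. Then $k=k'$ and there is a permutation $\sigma$ of $\{1,\dots,k\}$ such that, for every $i$, the matroid $M'_{\sigma(i)}$ is isomorphic to $M_i$ or to the dual matroid $M_i^*$.
   Context: A matroid $M$ on a finite ground set $E$ is given by its nonempty collection $\mathcal{B}$ of bases, satisfying: for all $A,B\in\mathcal{B}$ and $a\in A\setminus B$ there is $b\in B\setminus A$ with $(A\setminus\{a\})\cup\{b\}\in\mathcal{B}$ and $(B\setminus\{b\})\cup\{a\}\in\mathcal{B}$. The basis exchange graph $G(M)$ has node set $\mathcal{B}$, and $A,B\in\mathcal{B}$ are adjacent if and only if $|A\setminus B|=1$; it is called abstract if the labelling of its nodes by bases is not given. Two matroids are isomorphic if there is a bijection of their ground sets mapping bases to bases. The dual $M^*$ has ground set $E$ and bases $\{E\setminus B : B\in\mathcal{B}\}$. A loop is an element contained in no basis; a coloop is an element contained in every basis. For matroids $M_1,M_2$ on disjoint ground sets $E_1,E_2$, the direct sum $M_1\oplus M_2$ is the matroid on $E_1\cup E_2$ with bases $B_1\cup B_2$, where $B_i$ is a basis of $M_i$. A matroid is connected if it is not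 the direct sum of two matroids with nonempty ground sets; every matroid is a direct sum of connected matroids, whose ground sets are its connected components. Removing all loops and coloops means passing to the ground set of elements that are neither loops nor coloops, with bases $B\setminus\{\text{coloops}\}$, $B\in\mathcal{B}$ (if nothing remains, there are $k=0$ summands). *)

(* Defs.v *)
From Stdlib Require Classical_Prop.
From mathcomp Require Import all_boot all_fingroup.

Set Implicit Arguments.
Unset Strict Implicit.
Unset Printing Implicit Defensive.

(* The ground set is an arbitrary subset of the finite type T, so that the
   direct summands of a matroid over T are again matroids over T. *)
Record matroid (T : finType) := Matroid {
  ground : {set T};
  bases : {set {set T}};
  bases_neq0 : bases != set0;
  bases_sub_ground : forall B, B \in bases -> B \subset ground;
  bases_exchange : forall A B, A \in bases -> B \in bases ->
    forall a, a \in A :\: B ->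
    exists b, [/\ b \in B :\: A, b |: (A :\ a) \in bases
                & a |: (B :\ b) \in bases]
}.

Section OneMatroid.
Variables (T : finType) (M : matroid T).

Definition basis_node : finType := {B : {set T} | B \in bases M}.

Definition basis_exchange_graph : rel basis_node :=
  fun A B => #|val A :\: val B| == 1.

Definition loops : {set T} :=
  [set x in ground M | [forall B in bases M, x \notin B]].

Definition coloops : {set T} :=
  [set x in ground M | [forall B in bases M, x \in B]].

Definition dual_bases : {set {set T}} := [set ground M :\: B | B in bases M].

Fact dual_bases_neq0 : dual_bases != set0.
Proof.
have /set0Pn [B BM] := bases_neq0 M.
by apply/set0Pn; exists (ground M :\: B); apply: imset_f.
Qed.

Fact dual_bases_sub_ground B : B \in dual_bases -> B \subset ground M.
Proof. by case/imsetP=> A _ ->; apply: subsetDl. Qed.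

Fact dual_bases_exchange A B : A \in dual_bases -> B \in dual_bases ->
  forall a, a \in A :\: B ->
  exists b, [/\ b \in B :\: A, b |: (A :\ a) \in dual_bases
              & a |: (B :\ b) \in dual_bases].
Proof.
case/imsetP=> A0 A0M ->; case/imsetP=> B0 B0M -> a.
rewrite !inE => /andP[aB /andP[aA aE]].
have aB0 : a \in B0 by move: aB; rewrite aE andbT negbK.
have aBA : a \in B0 :\: A0 by rewrite inE aA.
have [b [bAB B1 A1]] := bases_exchange B0M A0M aBA.
move: bAB; rewrite inE => /andP[bB bA].
have bE : b \in ground M := subsetP (bases_sub_ground A0M) _ bA.
have nab : (a == b) = false by apply/negbTE; apply: contraNneq aA => ->.
exists b; split; first by rewrite !inE bA bB bE.
- apply/imsetP; exists (a |: (A0 :\ b)) => //; apply/setP => x.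
  rewrite !inE; have [->|_] := eqVneq x b; first by rewrite (eq_sym b) nab bE.
  by case: (x == a).
- apply/imsetP; exists (b |: (B0 :\ a)) => //; apply/setP => x.
  rewrite !inE; have [->|_] := eqVneq x a; first by rewrite nab aE.
  by case: (x == b).
Qed.

Definition dual_matroid : matroid T :=
  Matroid dual_bases_neq0 dual_bases_sub_ground dual_bases_exchange.

Definition core_ground : {set T} := ground M :\: (loops :|: coloops).

Definition core_bases : {set {set T}} := [set B :\: coloops | B in bases M].

Fact core_bases_neq0 : core_bases != set0.
Proof.
have /set0Pn [B BM] := bases_neq0 M.
by apply/set0Pn; exists (B :\: coloops); apply: imset_f.
Qed.

Fact core_bases_sub_ground B : B \in core_bases -> B \subset core_ground.
Proof.
case/imsetP=> A AM ->; apply/subsetP => x; rewrite in_setD => /andP[xC xA].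
have xE : x \in ground M := subsetP (bases_sub_ground AM) _ xA.
rewrite in_setD in_setU negb_or xC xE !andbT in_set xE /=.
by apply/forall_inPn; exists A => //; rewrite negbK.
Qed.

Fact core_bases_exchange A B : A \in core_bases -> B \in core_bases ->
  forall a, a \in A :\: B ->
  exists b, [/\ b \in B :\: A, b |: (A :\ a) \in core_bases
              & a |: (B :\ b) \in core_bases].
Proof.
case/imsetP=> A0 A0M ->; case/imsetP=> B0 B0M -> a.
rewrite !in_setD => /andP[aB /andP[aC aA]].
have aAB : a \in A0 :\: B0 by move: aB; rewrite aC !inE aA andbT => ->.
have [b [bBA A1 B1]] := bases_exchange A0M B0M aAB.
have bC : b \notin coloops.
  apply: contraL bBA; rewrite inE => /andP[_ /forall_inP /(_ _ A0M) bA].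
  by rewrite inE bA.
exists b; split; first by move: bBA; rewrite !in_setD bC => /andP[-> ->].
- apply/imsetP; exists (b |: (A0 :\ a)) => //; apply/setP => x.
  rewrite !(in_setU, in_setD, in_set1).
  by have [->|_] := eqVneq x b; rewrite ?bC //= andbCA.
- apply/imsetP; exists (a |: (B0 :\ b)) => //; apply/setP => x.
  rewrite !(in_setU, in_setD, in_set1).
  by have [->|_] := eqVneq x a; rewrite ?aC //= andbCA.
Qed.

Definition remove_loops_coloops : matroid T :=
  Matroid core_bases_neq0 core_bases_sub_ground core_bases_exchange.

End OneMatroid.

Definition is_direct_sum2 (T : finType) (M M1 M2 : matroid T) : Prop :=
  [/\ [disjoint ground M1 & ground M2],
      ground M = ground M1 :|: ground M2
    & bases M = [set B1 :|: B2 | B1 in bases M1, B2 in bases M2]].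

Definition connected_matroid (T : finType) (M : matroid T) : Prop :=
  ~ exists M1 M2 : matroid T,
      [/\ ground M1 != set0, ground M2 != set0 & is_direct_sum2 M M1 M2].

Definition is_direct_sum (T : finType) (M : matroid T)
    (k : nat) (N : 'I_k -> matroid T) : Prop :=
  [/\ forall i j, i != j -> [disjoint ground (N i) & ground (N j)],
      ground M = \bigcup_i ground (N i)
    & bases M = [set \bigcup_i B i
                | B : {ffun 'I_k -> {set T}} in family (fun i => bases (N i))]].

(* Summands must be nonempty: the matroid with empty ground set satisfies
   connected_matroid, and it has k = 0 connected summands. *)
Definition are_connected_summands (T : finType) (M : matroid T)
    (k : nat) (N : 'I_k -> matroid T) : Prop :=
  is_direct_sum M N /\
  forall i, ground (N i) != set0 /\ connected_matroid (N i).

(* The bijection is between the ground sets, not between T and T', which may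
   have different cardinalities. *)
Definition isomorphic (T T' : finType) (M : matroid T) (M' : matroid T') :
    Prop :=
  exists f : {x | x \in ground M} -> {y | y \in ground M'},
    bijective f /\
    forall B : {set {x | x \in ground M}},
      (val @: B \in bases M) = (val @: (f @: B) \in bases M').

Definition graph_isomorphic (V V' : finType) (e : rel V) (e' : rel V') : Prop :=
  exists2 f : V -> V', bijective f & forall x y, e' (f x) (f y) = e x y.

Lemma connected_summands_exist (T : finType) (M : matroid T) :
  exists (k : nat) (N : 'I_k -> matroid T), are_connected_summands M N.
Proof.
have [n] := ubnP #|ground M|; elim: n M => // n IHn M ltMn.
have [E0|EN0] := eqVneq (ground M) set0.
  exists 0, (fun=> M); split; last by case.
  split; [by case|by rewrite big_ord0|].
  have B0 B : B \in bases M -> B = set0.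
    by move=> /(bases_sub_ground); rewrite E0 subset0 => /eqP.
  have /set0Pn[B1 B1M] := bases_neq0 M.
  apply/setP=> B; apply/idP/imsetP=> [BM|[F _ ->]].
    exists [ffun=> set0]; last by rewrite big_ord0 (B0 _ BM).
    by apply/familyP; case.
  by rewrite big_ord0 -(B0 _ B1M).
have [|] := Classical_Prop.classic (connected_matroid M) => [cM|/Classical_Prop.NNPP].
  exists 1, (fun=> M); split=> //; split.
  - by move=> i j; rewrite !ord1 eqxx.
  - by rewrite big_ord1.
  apply/setP=> B; apply/idP/imsetP=> [BM|[F /familyP FM ->]]; last first.
    by rewrite big_ord1; apply: FM.
  exists [ffun=> B]; last by rewrite big_ord1 ffunE.
  by apply/familyP=> i; rewrite ffunE.
case=> M1 [M2 [E1 E2 [dE defE defB]]].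
have cE : #|ground M| = #|ground M1| + #|ground M2|.
  by rewrite defE cardsU (disjoint_setI0 dE) cards0 subn0.
rewrite -card_gt0 in E1; rewrite -card_gt0 in E2.
have [|k1 [N1 [[d1 g1 b1] c1]]] := IHn M1.
  by rewrite -ltnS; apply: leq_trans ltMn; rewrite ltnS cE -addn1 leq_add2l.
have [|k2 [N2 [[d2 g2 b2] c2]]] := IHn M2.
  by rewrite -ltnS; apply: leq_trans ltMn; rewrite ltnS cE -add1n leq_add2r.
pose N i := match split i with inl i1 => N1 i1 | inr i2 => N2 i2 end.
have NL i : N (lshift k2 i) = N1 i by rewrite /N (unsplitK (inl _ i)).
have NR i : N (rshift k1 i) = N2 i by rewrite /N (unsplitK (inr _ i)).
have dN i j : [disjoint ground (N1 i) & ground (N2 j)].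
  apply: disjointWl (disjointWr _ dE); first by rewrite g1 (bigcup_max i).
  by rewrite g2 (bigcup_max j).
exists (k1 + k2), N; split; last first.
  by move=> i; rewrite /N; case: (split i).
split.
- move=> i j; rewrite -(splitK i) -(splitK j).
  case: (split i) => i'; case: (split j) => j' /=; rewrite ?NL ?NR => nij //.
  + by apply: d1; apply: contraNneq nij => ->.
  + by rewrite disjoint_sym.
  + by apply: d2; apply: contraNneq nij => ->.
- rewrite defE g1 g2 big_split_ord /=; congr (_ :|: _);
    by apply: eq_bigr => i _; rewrite ?NL ?NR.
rewrite defB b1 b2; apply/setP=> B; apply/imset2P/imsetP.
  case=> _ _ /imsetP[F1 /familyP F1P ->] /imsetP[F2 /familyP F2P ->] ->.
  exists [ffun i => match split i with inl j => F1 j | inr j => F2 j end].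
    apply/familyP=> i; rewrite ffunE /N.
    by case: (split i) => j; [apply: F1P|apply: F2P].
  rewrite big_split_ord /=; congr (_ :|: _); apply: eq_bigr => i _;
    by rewrite ffunE ?(unsplitK (inl _ i)) ?(unsplitK (inr _ i)).
case=> F /familyP FP ->; rewrite big_split_ord /=.
exists (\bigcup_i F (lshift k2 i)) (\bigcup_i F (rshift k1 i)) => //.
  apply/imsetP; exists [ffun i => F (lshift k2 i)].
    by apply/familyP=> i; rewrite ffunE -NL; apply: FP.
  by apply: eq_bigr => i _; rewrite ffunE.
apply/imsetP; exists [ffun i => F (rshift k1 i)].
  by apply/familyP=> i; rewrite ffunE -NR; apply: FP.
by apply: eq_bigr => i _; rewrite ffunE.
Qed.

(* Main.v *)
(* Fix a basis [B] of [M] with image [B'] in [M']. The neighbourhood of [B] in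
   the exchange graph is the line graph of a bipartite graph on the core, so
   the graph isomorphism induces a bijection [f] of the cores carrying the
   symmetric difference [A + B] to [A' + B'] for every neighbour [A] of [B].
   A basis at distance two from [B] is determined by two of its common
   neighbours with [B], hence the same holds for all bases.  Separators can be
   defined by mixing bases, so [f] maps connected components to connected
   components.  Finally, the set of [u] such that [u] is in [B] iff [f u] is in
   [B'] meets all bases of [M] in equally many elements, hence is a separator:
   on each component, [f] either preserves or complements bases. *)
Require Import Defs.
From mathcomp Require Import all_boot all_fingroup.

Set Implicit Arguments.
Unset Strict Implicit.
Unset Printing Implicit Defensive.

(** * Exchanging single elements between sets of equal size *)

Section Sets.
Variable T : finType.
Implicit Types A B C P Q : {set T}.

(** A sum over the subtype can be reindexed along a bijection, which allows sizes of sets over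
    different types to be compared. *)
Lemma sum_mem_card P A : A \subset P ->
  #|A| = \sum_(u : {x | x \in P}) (val u \in A).
Proof.
move=> sA; have {1}-> : A = val @: [set u : {x | x \in P} | val u \in A].
  apply/setP => x; apply/idP/imsetP => [xA|[u + ->]]; last by rewrite inE.
  by exists (exist (fun x => x \in P) x (subsetP sA _ xA)); rewrite ?inE.
rewrite card_imset; last exact: val_inj.
rewrite -sum1_card big_mkcond; apply: eq_bigr => u _.
by rewrite inE; case: (val u \in A).
Qed.

Lemma card1_setDP A C : #|A| = #|C| ->
  reflect (exists x y, [/\ x \in A, y \notin A & C = y |: (A :\ x)])
          (#|A :\: C| == 1).
Proof.
move=> AC; apply: (iffP idP) => [A1|[x [y [xA yA ->]]]].
  have : #|C :\: A| == 1 by rewrite cardsD -AC setIC -cardsD.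
  case/cards1P: A1 => x /setP Ax /cards1P[y /setP Cy].
  have := Ax x; have := Cy y.
  rewrite !inE !eqxx => /andP[yA yC] /andP[xC xA].
  exists x, y; split=> //; apply/setP => z; have := Ax z; have := Cy z.
  rewrite !inE; have [->|_] := eqVneq z x.
    by rewrite (negbTE xC) xA orbF => <-.
  by case: (z == y); case: (z \in A); case: (z \in C).
apply/cards1P; exists x; apply/setP => z; rewrite !inE.
have [->|_] := eqVneq z x.
  by rewrite xA orbF !andbT; apply: contraNneq yA => <-.
by have [->|_] := eqVneq z y; rewrite ?andNb.
Qed.

(** A neighbour of [B] is seen as an edge from the removed [x] to the added [y]. Two neighbours
    coincide or are adjacent exactly when their edges share an end, so the neighbourhood of [B] is
    the line graph of a bipartite graph. *)
Lemma setU1D1_card1 B x y x' y' :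
    x \in B -> y \notin B -> x' \in B -> y' \notin B ->
  (y |: (B :\ x) == y' |: (B :\ x')) ||
  (#|(y |: (B :\ x)) :\: (y' |: (B :\ x'))| == 1) = (x == x') || (y == y').
Proof.
move=> xB yB x'B y'B.
have ne b c : b \in B -> c \notin B -> (b == c = false) * (c == b = false).
  move=> bB cB; suff /negbTE bc : b != c by rewrite bc eq_sym bc.
  by apply: contraNneq cB => <-.
have [<-|nx] := eqVneq x x'.
  have [<-|ny] := eqVneq y y'; first by rewrite eqxx.
  apply/orP; right; apply/cards1P; exists y; apply/setP => z; rewrite !inE.
  have [->|_] := eqVneq z y; first by rewrite (negbTE ny) (negbTE yB) andbF.
  by case: (z == x); case: (z \in B); rewrite ?orbT ?andbF.
have [<-|ny] /= := eqVneq y y'.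
  apply/orP; right; apply/cards1P; exists x'; apply/setP => z; rewrite !inE.
  have [->|_] := eqVneq z x'; first by rewrite (ne _ y) // x'B eq_sym nx.
  by case: (z == y); case: (z \in B); rewrite ?andbF.
apply/negbTE; rewrite negb_or; apply/andP; split.
  apply: contra_neqN nx => /eqP/setP/(_ x); rewrite !inE eqxx xB (ne x y) //.
  rewrite ?(ne x y') //= andbT.
  by move/esym/negbFE/eqP.
have -> : (y |: (B :\ x)) :\: (y' |: (B :\ x')) = [set y; x'].
  apply/setP => z; rewrite !inE.
  have [->|_] := eqVneq z y.
    by rewrite (negbTE ny) (negbTE yB) andbF.
  have [->|_] := eqVneq z x'; first by rewrite x'B (ne _ y') // eq_sym nx.
  by case: (z == y'); case: (z == x); case: (z \in B).
by rewrite cards2 (ne x' y).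
Qed.

(* In the halved cube, [P + Q + C] (symmetric differences) is the only common
   neighbour of [P] and [Q] that is neither [C] nor a neighbour of [C]. *)
Lemma square_xor C P Q A :
    #|C| = #|A| -> #|C| = #|P| -> #|C| = #|Q| ->
    #|C :\: P| == 1 -> #|C :\: Q| == 1 -> #|P :\: A| == 1 -> #|Q :\: A| == 1 ->
    P != Q -> #|P :\: Q| != 1 -> C != A -> #|C :\: A| != 1 ->
  forall z, (z \in A) = (z \in P) (+) (z \in Q) (+) (z \in C).
Proof.
move=> CA CP CQ /card1_setDP-/(_ CP)[c [p [cC pC dP]]].
move=> /card1_setDP-/(_ CQ)[c' [p' [c'C p'C dQ]]].
have PA : #|P| = #|A| by rewrite -CP.
have QA : #|Q| = #|A| by rewrite -CQ.
move=> /card1_setDP-/(_ PA)[x [y [xP yP dA]]] QA1 nPQ PQ nCA nCA1.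
(* As [P] and [Q] are distinct and not adjacent, their edges at [C] are disjoint. *)
have := setU1D1_card1 cC pC c'C p'C.
rewrite -dP -dQ (negbTE nPQ) (negbTE PQ) => /esym/negbT.
rewrite negb_or => /andP[cc' pp'].
have ne b d : b \in C -> d \notin C -> (b == d = false) * (d == b = false).
  move=> bC dC; suff /negbTE bd : b != d by rewrite bd eq_sym bd.
  by apply: contraNneq dC => <-.
have cp := ne _ _ cC pC.
(* Removing the element just added to [C] would lead back to [C] or to one of its neighbours. *)
have xp : x != p.
  apply/negP => /eqP xp; move: yP; rewrite dP !inE negb_or negb_and negbK.
  case/andP=> yp /orP[/eqP yc|yC].
    case/negP: nCA; apply/eqP/setP => z; rewrite dA xp yc dP !inE.
    have [->|_] := eqVneq z c; first by rewrite cC.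
    by have [->|_] := eqVneq z p; rewrite ?(negbTE pC).
  case/negP: nCA1; apply/card1_setDP => //; exists c, y; split => //.
  apply/setP => z; rewrite dA xp dP !inE.
  by have [->|_] := eqVneq z p; rewrite ?(negbTE pC) ?andbF.
have {}xP : (x != c) && (x \in C) by move: xP; rewrite dP !inE (negbTE xp).
case/andP: xP => xc xC.
have [yp yC] : y != p /\ y \notin C.
  move: yP; rewrite dP !inE negb_or negb_and negbK => /andP[yp yC].
  split=> //; case/orP: yC => // /eqP yc; case/negP: nCA1.
  apply/card1_setDP => //; exists x, p; split => //.
  apply/setP => z; rewrite dA yc dP !inE.
  have [->|_] := eqVneq z c; first by rewrite eq_sym xc cC orbT.
  have [->|_] := eqVneq z p; rewrite ?(negbTE pC) ?andbF ?orbF //.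
  by rewrite eq_sym xp.
have pA : p \in A by rewrite dA dP !inE eqxx (eq_sym p x) xp orbT.
have yA : y \in A by rewrite dA !inE eqxx.
have cA : c \notin A.
  by rewrite dA dP !inE (ne c y) // cp eqxx /= andbF.
have xA : x \notin A by rewrite dA !inE (ne x y) // eqxx.
(* So far [A] is [C] with [c], [x] replaced by [p], [y]. It is also a neighbour of [Q]: if [y] were
   not [p'], both [p] and [y] would lie in [A :\: Q]; if [x] were not [c'], both [c] and [x] would
   lie in [Q :\: A]. *)
have yp' : y = p'.
  apply/eqP; apply: contraTT (QA1) => nyp'.
  have AQ1 : #|Q :\: A| = #|A :\: Q|.
    by rewrite !cardsD setIC QA.
  rewrite AQ1 neq_ltn; apply/orP; right.
  have <- : #|[set p; y]| = 2 by rewrite cards2 eq_sym yp.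
  apply: subset_leq_card; apply/subsetP => z; rewrite !inE.
  case/orP => /eqP ->; rewrite ?pA ?yA dQ !inE ?(negbTE pC) ?(negbTE yC).
    by rewrite (negbTE pp') andbF.
  by rewrite (negbTE nyp') andbF.
have xc' : x = c'.
  apply/eqP; apply: contraTT (QA1) => nxc'.
  rewrite neq_ltn; apply/orP; right.
  have <- : #|[set c; x]| = 2 by rewrite cards2 eq_sym xc.
  apply: subset_leq_card; apply/subsetP => z; rewrite !inE.
  case/orP => /eqP ->; rewrite ?cA ?xA dQ !inE ?cC ?xC.
    by rewrite cc' orbT.
  by rewrite nxc' orbT.
move=> z; rewrite dA dP dQ yp' xc' !inE.
have [->|_] := eqVneq z p.
  by rewrite (negbTE pC) (negbTE pp') (ne c' p) // andbF.
have [->|_] := eqVneq z p'; first by rewrite (negbTE p'C) andbF.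
have [->|_] := eqVneq z c; first by rewrite cC cc'.
by case: (z == c'); case: (z \in C).
Qed.

End Sets.

(** * Bases, separators and restrictions to separators *)

Section Bases.
Variables (T : finType) (M : matroid T).
Implicit Types A B C S : {set T}.

Lemma basis_subset_eq A B :
  A \in bases M -> B \in bases M -> A \subset B -> A = B.
Proof.
move=> AM BM sAB; apply/eqP; rewrite eqEsubset sAB; apply/subsetP => b bB.
apply/negPn/negP => bA; have bBA : b \in B :\: A by rewrite inE bA.
have [a [aAB _ _]] := bases_exchange BM AM bBA.
by move: aAB; rewrite inE => /andP[/negP aB /(subsetP sAB)].
Qed.

Lemma card_basis A B : A \in bases M -> B \in bases M -> #|A| = #|B|.
Proof.
move=> AM BM; have [n] := ubnP #|A :\: B|; elim: n A AM => // n IHn A AM.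
have [AB0 _|[a aAB]] := set_0Vmem (A :\: B).
  by rewrite (basis_subset_eq AM BM) // -setD_eq0 AB0.
have [b [bBA A1M _]] := bases_exchange AM BM aAB.
rewrite ltnS => leAB; move: (aAB) (bBA); rewrite !inE.
case/andP=> aB aA /andP[bA bB].
rewrite -(IHn _ A1M).
  by rewrite cardsU1 !inE (negbTE bA) andbF (cardsD1 a A) aA.
apply: leq_trans leAB; rewrite (cardsD1 a (A :\: B)) aAB add1n ltnS.
apply: subset_leq_card; apply/subsetP => z; rewrite !inE.
by have [->|_] := eqVneq z b; rewrite ?bB // andbCA.
Qed.

Lemma basis_neighbourP A C : A \in bases M -> C \in bases M ->
  reflect (exists x y, [/\ x \in A, y \notin A & C = y |: (A :\ x)])
          (#|A :\: C| == 1).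
Proof. by move=> AM CM; apply: card1_setDP; apply: card_basis. Qed.

(** The induction step for moving [C] towards [A]: one exchange removes exactly [a] from the
    difference. *)
Lemma setD_basis_step A C a : A \in bases M -> C \in bases M ->
    a \in A :\: C ->
  exists c, [/\ c \in C, a |: (C :\ c) \in bases M, c |: (A :\ a) \in bases M,
    c \notin A & A :\: (a |: (C :\ c)) = (A :\: C) :\ a].
Proof.
move=> AM CM aAC; have [c [cCA A1 C1]] := bases_exchange AM CM aAC.
move: cCA; rewrite inE => /andP[cA cC]; exists c; split=> //.
apply/setP => z; rewrite !inE negb_or negb_and negbK.
by have [->|_] := eqVneq z c; rewrite ?(negbTE cA) ?andbF //= -andbA.
Qed.

(** This is splitting of [M] along [S], phrased by mixing bases, with no rank function. [S] may
    leave the ground set, so that complements can be taken in [T]. *)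
Definition separator S := forall A C, A \in bases M -> C \in bases M ->
  (A :&: S) :|: (C :\: S) \in bases M.

(** Move [C] towards [A] by exchanges at elements [a] of [S]. The partner [c] is again in [S], as
    otherwise the basis obtained from [A] would meet [S] in one element fewer. Thus [C] is unchanged
    outside [S] and finally agrees with [A] on [S]. *)
Lemma separator_card B S :
  (forall A, A \in bases M -> #|A :&: S| = #|B :&: S|) -> separator S.
Proof.
move=> cS A C AM CM; have [n] := ubnP #|(A :\: C) :&: S|.
elim: n C CM => // n IHn C CM; rewrite ltnS => leAC.
have [AC0|[a]] := set_0Vmem ((A :\: C) :&: S).
  suff -> : A :&: S = C :&: S by rewrite setID.
  apply/eqP; rewrite eqEcard (cS _ AM) (cS _ CM) leqnn andbT.
  apply/subsetP => z; rewrite !inE => /andP[zA zS]; rewrite zS andbT.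
  by have := in_set0 z; rewrite -AC0 !inE zA zS !andbT => /negbFE.
rewrite in_setI => /andP[aAC aS].
have [c [cC C1M A1M cA dAC]] := setD_basis_step AM CM aAC.
have aA : a \in A by case/setDP: aAC.
have cS' : c \in S.
  apply: contraT => cS'; have := cS _ A1M; rewrite -(cS _ AM).
  have -> : (c |: (A :\ a)) :&: S = (A :&: S) :\ a.
    apply/setP => z; rewrite !inE.
    by have [->|_] := eqVneq z c; rewrite ?(negbTE cS') ?andbF // andbA.
  by rewrite [RHS](cardsD1 a) inE aA aS => /eqP; rewrite eqn_leq ltnn andbF.
have := IHn _ C1M; rewrite dAC.
have -> : ((A :\: C) :\ a) :&: S = ((A :\: C) :&: S) :\ a.
  by rewrite setIDAC.
have -> : (a |: (C :\ c)) :\: S = C :\: S.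
  apply/setP => z; rewrite !inE; have [->|_] := eqVneq z a; first by rewrite aS.
  by have [->|_] := eqVneq z c; rewrite ?cS'.
apply; apply: leq_trans leAC.
by rewrite [ltnRHS](cardsD1 a) in_setI aAC aS.
Qed.

Section Restriction.
Variables (S : {set T}) (sepS : separator S).

Definition restr_bases : {set {set T}} := [set A :&: S | A in bases M].

Fact restr_bases_neq0 : restr_bases != set0.
Proof.
have /set0Pn [B BM] := bases_neq0 M.
by apply/set0Pn; exists (B :&: S); apply: imset_f.
Qed.

Fact restr_bases_sub_ground B :
  B \in restr_bases -> B \subset ground M :&: S.
Proof. by case/imsetP=> A AM ->; apply/setSI/bases_sub_ground. Qed.

Fact restr_bases_exchange A B : A \in restr_bases -> B \in restr_bases ->
  forall a, a \in A :\: B ->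
  exists b, [/\ b \in B :\: A, b |: (A :\ a) \in restr_bases
              & a |: (B :\ b) \in restr_bases].
Proof.
case/imsetP=> A0 A0M ->; case/imsetP=> B0 B0M -> a aAB.
have [aS aA aB] : [/\ a \in S, a \in A0 & a \notin B0].
  move: aAB; rewrite !inE; case: (a \in S); rewrite ?andbT ?andbF //.
  by case/andP.
(* Exchanging with a basis that equals [B0] on [S] and [A0] off [S] forces the incoming element into
   [S]. *)
have B1M := sepS B0M A0M.
have aAB1 : a \in A0 :\: ((B0 :&: S) :|: (A0 :\: S)).
  by rewrite !inE aS (negbTE aB) aA.
have [b [bB1 A2M B2M]] := bases_exchange A0M B1M aAB1.
have [bS bB bA] : [/\ b \in S, b \in B0 & b \notin A0].
  move: bB1; rewrite !inE.
  by case: (b \in S); case: (b \in A0); case: (b \in B0).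
exists b; rewrite !inE (negbTE bA) bB bS; split=> //.
- apply/imsetP; exists (b |: (A0 :\ a)) => //; apply/setP => z; rewrite !inE.
  by have [->|_] := eqVneq z b; rewrite ?bS //= andbA.
- apply/imsetP; exists (a |: (((B0 :&: S) :|: (A0 :\: S)) :\ b)) => //.
  apply/setP => z; rewrite !inE.
  have [->|_] := eqVneq z a; first by rewrite aS.
  by case: (z \in S); rewrite ?andbF ?andbT ?orbF //= andbF.
Qed.

Definition restr_matroid : matroid T :=
  Matroid restr_bases_neq0 restr_bases_sub_ground restr_bases_exchange.

End Restriction.

Lemma separatorC S : separator S -> separator (~: S).
Proof.
by move=> sS A C AM CM; rewrite (setDE C) setCK -setDE setUC; apply: sS.
Qed.

(** Otherwise the restrictions to [S] and to its complement would be a direct sum decomposition with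
    nonempty ground sets. *)
Lemma connected_separator S : connected_matroid M -> separator S ->
  ground M \subset S \/ [disjoint ground M & S].
Proof.
move=> cM sS; have [|nS] := boolP (ground M \subset S); first by left.
have [|nD] := boolP [disjoint ground M & S]; first by right.
case: cM; exists (restr_matroid sS), (restr_matroid (separatorC sS)).
split=> /=; [by rewrite setI_eq0 | by rewrite -setDE setD_eq0 |].
split=> /=.
- by rewrite -setI_eq0 setIACA setICr setI0.
- by rewrite -setDE setID.
apply/setP => B; apply/idP/imset2P
    => [BM|[_ _ /imsetP[A AM ->] /imsetP[C CM ->] ->]].
  exists (B :&: S) (B :&: ~: S); [exact: imset_f | exact: imset_f |].
  by rewrite -setDE setID.
by rewrite -setDE; apply: sS.
Qed.

End Bases.

(** * Summands of a direct sum, as traces of bases and as separators *)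

Section DirectSum.
Variables (T : finType) (M : matroid T) (k : nat) (N : 'I_k -> matroid T).
Hypothesis sumN : is_direct_sum M N.

Lemma summand_inj i j x : x \in ground (N i) -> x \in ground (N j) -> i = j.
Proof.
have [dN _ _] := sumN => xi xj; apply/eqP; apply: contraT => /dN.
by move/disjointFr/(_ xi); rewrite xj.
Qed.

Lemma in_bigcup_summand (F : 'I_k -> {set T}) i x :
    (forall j, F j \in bases (N j)) -> x \in ground (N i) ->
  (x \in \bigcup_j F j) = (x \in F i).
Proof.
move=> FN xi; apply/bigcupP/idP => [[j _ xFj]|]; last by exists i.
by rewrite (summand_inj xi (subsetP (bases_sub_ground (FN j)) _ xFj)).
Qed.

Lemma bigcup_basis (F : 'I_k -> {set T}) :
  (forall j, F j \in bases (N j)) -> \bigcup_j F j \in bases M.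
Proof.
have [_ _ ->] := sumN => FN; apply/imsetP; exists (finfun F).
  by apply/familyP => i; rewrite ffunE.
by apply: eq_bigr => i _; rewrite ffunE.
Qed.

Lemma basis_bigcup A : A \in bases M ->
  exists2 F : 'I_k -> {set T},
    forall j, F j \in bases (N j) & A = \bigcup_j F j.
Proof.
have [_ _ ->] := sumN => /imsetP[F /familyP FN ->].
by exists F.
Qed.

Lemma ground_summand i : ground (N i) \subset ground M.
Proof. by have [_ -> _] := sumN; apply: bigcup_sup. Qed.

Lemma bigcup_setI_summand (F : 'I_k -> {set T}) i :
  (forall j, F j \in bases (N j)) -> (\bigcup_j F j) :&: ground (N i) = F i.
Proof.
move=> FN; apply/setP => x; rewrite inE.
have [xi|xi] := boolP (x \in ground (N i)).
  by rewrite andbT (in_bigcup_summand FN xi).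
rewrite andbF; apply/esym/negP => /(subsetP (bases_sub_ground (FN i))).
exact/negP.
Qed.

Lemma bases_summand i : bases (N i) = [set A :&: ground (N i) | A in bases M].
Proof.
apply/setP => D; apply/idP/imsetP => [DN|[A /basis_bigcup[F FN ->] ->]].
  have /fin_all_exists[F0 F0N] j : exists B, B \in bases (N j).
    by have /set0Pn := bases_neq0 (N j).
  (* A basis of one summand is completed by arbitrary bases of the others. *)
  pose F j := if j == i then D else F0 j.
  have FN j : F j \in bases (N j) by rewrite /F; case: eqP => [->|].
  exists (\bigcup_j F j); first exact: bigcup_basis.
  by rewrite (bigcup_setI_summand _ FN) /F eqxx.
by rewrite bigcup_setI_summand.
Qed.

Lemma separator_summand i : separator M (ground (N i)).
Proof.
move=> _ _ /basis_bigcup[F FN ->] /basis_bigcup[G GN ->].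
pose H j := if j == i then F j else G j.
have HN j : H j \in bases (N j) by rewrite /H; case: eqP.
suff -> : (\bigcup_j F j) :&: ground (N i) :|: (\bigcup_j G j) :\: ground (N i)
    = \bigcup_j H j by apply: bigcup_basis.
have sub K j x : (forall j, K j \in bases (N j)) -> x \in K j ->
    (x \in ground (N i)) = (j == i).
  move=> KN xK; have xj := subsetP (bases_sub_ground (KN j)) _ xK.
  by apply/idP/eqP => [/(summand_inj xj)|<-].
apply/setP => x; rewrite bigcup_setI_summand // !inE.
apply/idP/bigcupP => [/orP[xF|/andP[xi /bigcupP[j _ xG]]]|[j _ xH]].
- by exists i; rewrite // /H eqxx.
- by exists j; rewrite // /H -(sub G j x) // (negbTE xi).
rewrite (sub H j x) //; move: xH; rewrite /H; case: eqP => [->->//|_ xG] /=.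
by apply/orP; right; apply/bigcupP; exists j.
Qed.

Lemma separator_restr_summand S i : separator M S -> separator (N i) S.
Proof.
move=> sS A C; rewrite !bases_summand => /imsetP[A0 A0M ->] /imsetP[C0 C0M ->].
apply/imsetP; exists ((A0 :&: S) :|: (C0 :\: S)); first exact: sS.
by rewrite setIUl setIAC setIDAC.
Qed.

End DirectSum.

(** * Isomorphisms between line graphs of bipartite graphs *)

Section LineGraphs.

(** If [w] and [x] meet [v] at its two different ends, then an end common to [w] and [x] makes one
    of them parallel to [v], hence equal to [v]. So a triangle of distinct edges is a star. *)
Lemma line_graph_triangle (V : Type) (T : eqType) (e : V -> bool -> T)
    v w x a u :
    (forall v w, (forall s, e v s = e w s) -> v = w) ->
    e v a = e w a -> e v (~~ a) = e x (~~ a) -> e w u = e x u ->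
  v = w \/ v = x.
Proof.
move=> e_inj vw vx wx; have [ua|ua] := eqVneq u a.
  right; apply: e_inj => s; case: (eqVneq s a) => [->|].
    by rewrite vw -ua.
  by move/negPf; rewrite -[s == a]negbK => /negbFE; case: s a vx {vw ua} => -[].
left; apply: e_inj => s; case: (eqVneq s a) => [->//|sa].
have <- : u = s by case: u s a ua sa {vw vx wx} => -[] [].
by rewrite wx; case: u a ua vx {vw wx sa} => -[].
Qed.

Variables (V V' : finType) (T T' : eqType).
Variables (e : V -> bool -> T) (e' : V' -> bool -> T') (phi : V -> V').
Hypothesis phi_inj : injective phi.
Hypothesis e_inj : forall v w, (forall s, e v s = e w s) -> v = w.
Hypothesis e'_inj : forall v w, (forall s, e' v s = e' w s) -> v = w.
Hypothesis e_side : forall v w s s', e v s = e w s' -> s = s'.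
Hypothesis e'_side : forall v w s s', e' v s = e' w s' -> s = s'.
Hypothesis phi_share : forall v w,
  (exists s, e v s = e w s) <-> (exists s, e' (phi v) s = e' (phi w) s).

(* [t v] tells whether [phi] swaps the two sides of the bipartition at [v];
   triangles of the line graph are stars, so this does not depend on the
   neighbour of [v] used to read it off. *)
Lemma line_graph_twist : exists t : V -> bool, forall v w s s',
  e v s = e w s' <-> e' (phi v) (s (+) t v) = e' (phi w) (s' (+) t w).
Proof.
have /fin_all_exists[t tP] v : exists b : bool, forall w s,
    e v s = e w s -> e' (phi v) (s (+) b) = e' (phi w) (s (+) b).
  have [/existsP[w0 /andP[nw0 /existsP[s0 /eqP vw0]]]|none] :=
    boolP [exists w, (v != w) && [exists s, e v s == e w s]]; last first.
    (* An edge that meets no other edge admits either value; [false] is a default. *)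
    exists false => w s vw; have [<-//|nvw] := eqVneq v w.
    case/existsP: none; exists w; rewrite nvw; apply/existsP; exists s.
    exact/eqP.
  have [|s0' pvw0] := (phi_share v w0).1; first by exists s0.
  (* The value records whether the end shared with [w0] changes side. Another neighbour [w] cannot
     disagree: exactly one of the triples [v], [w], [w0] and its image would meet at both ends of
     its first edge, and the other, being a star, would turn it into a forbidden triangle. *)
  exists (s0 (+) s0') => w s vw; have [<-//|nvw] := eqVneq v w.
  have [|s' pvw] := (phi_share v w).1; first by exists s.
  suff <- : s' = s (+) (s0 (+) s0') by [].
  have [ss0|ss0] := eqVneq s s0.
    rewrite ss0 addbA addbb addFb; apply/eqP; apply: contraT => ns.
    have s0'E : s0' = ~~ s' by case: (s') (s0') ns => -[].
    have [|u pw] := (phi_share w w0).1; first by exists s; rewrite -vw ss0.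
    rewrite s0'E in pvw0.
    have [/phi_inj/eqP|/phi_inj/eqP] := line_graph_triangle e'_inj pvw pvw0 pw.
      by rewrite (negPf nvw).
    by rewrite (negPf nw0).
  have s0E : s0 = ~~ s by case: (s) (s0) ss0 => -[].
  rewrite s0E addbA addbN addbb; apply/eqP; rewrite addTb; apply: contraT => ns.
  have s'E : s' = s0' by case: (s') (s0') ns => -[].
  have [|u ww0] := (phi_share w w0).2; first by exists s'; rewrite -pvw s'E.
  rewrite s0E in vw0.
  have [/eqP|/eqP] := line_graph_triangle e_inj vw vw0 ww0.
    by rewrite (negPf nvw).
  by rewrite (negPf nw0).
(* With different twists, [phi v] and [phi w] would agree at both ends. *)
have tE v w s : e v s = e w s -> t v = t w.
  move=> vw; have pvw := tP _ _ _ vw; have pwv := tP _ _ _ (esym vw).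
  apply/eqP; apply: contraT => nt.
  have vweq : phi v = phi w.
    apply: e'_inj => s'; have [->//|ns'] := eqVneq s' (s (+) t v).
    by have -> : s' = s (+) t w by case: s' (s) (t v) (t w) nt ns' => -[] [] [].
  by rewrite (phi_inj vweq) eqxx in nt.
exists t => v w s s'; split=> [vw|pvw].
  have ss := e_side vw; rewrite -{}ss in vw *.
  by rewrite -(tE _ _ _ vw); apply: tP.
have ss := e'_side pvw.
have [|u vw] := (phi_share v w).2; first by exists (s (+) t v); rewrite {2}ss.
have tvw := tE _ _ _ vw.
have {ss}ss : s = s' by rewrite -(addbK (t v) s) ss tvw addbK.
rewrite -{}ss -{}tvw in pvw *.
have [->//|nus] := eqVneq s u.
have /phi_inj-> // : phi v = phi w.
apply: e'_inj => b; have [->//|nb] := eqVneq b (s (+) t v).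
have -> : b = u (+) t v by case: b s u (t v) nb nus {pvw vw} => -[] [] [].
exact: tP.
Qed.

End LineGraphs.

(** * The core and the neighbourhood of a basis *)

Section Core.
Variables (T : finType) (M : matroid T).
Implicit Types A B C : {set T}.

Definition node_of A (AM : A \in bases M) : basis_node M :=
  exist (fun B => B \in bases M) A AM.

Lemma core_groundP x : reflect
  (exists A C, [/\ A \in bases M, C \in bases M, x \in A & x \notin C])
  (x \in core_ground M).
Proof.
rewrite !inE; apply: (iffP idP) => [|[A [C [AM CM xA xC]]]].
  case/andP=> nlc xE; move: nlc; rewrite xE negb_or /=.
  case/andP=> /forall_inPn[A AM /negPn xA] /forall_inPn[C CM xC].
  by exists A, C.
rewrite (subsetP (bases_sub_ground AM) _ xA) andbT negb_or.
by apply/andP; split; apply/forall_inPn; [exists A; rewrite ?negbK | exists C].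
Qed.

Lemma notin_core A C x : A \in bases M -> C \in bases M ->
  x \notin core_ground M -> (x \in A) = (x \in C).
Proof.
move=> AM CM /core_groundP nx; apply/idP/idP => xA; apply: contraT => xC.
  by case: nx; exists A, C.
by case: nx; exists C, A.
Qed.

(** Ensures that the bipartite graph at [B] has no isolated vertices, so that a map of its edges
    reaches the whole core. *)
Lemma core_neighbour B x : B \in bases M -> x \in core_ground M ->
  exists2 A, A \in bases M & (#|B :\: A| == 1) && ((x \in A) != (x \in B)).
Proof.
move=> BM /core_groundP[A [C [AM CM xA xC]]].
have [xB|xB] := boolP (x \in B).
  have xBC : x \in B :\: C by rewrite inE xC.
  have [c [cB B1 _]] := bases_exchange BM CM xBC.
  have {}cB : c \notin B by case/setDP: cB.
  exists (c |: (B :\ x)) => //; apply/andP; split.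
    by apply/(basis_neighbourP BM B1); exists x, c.
  by rewrite !inE eqxx xB orbF eqb_id; apply: contraNneq cB => <-.
have xAB : x \in A :\: B by rewrite inE xB.
have [c [cB _ B1]] := bases_exchange AM BM xAB.
have {}cB : c \in B by case/setDP: cB.
exists (x |: (B :\ c)) => //; apply/andP; split.
  by apply/(basis_neighbourP BM B1); exists c, x.
by rewrite !inE eqxx (negPf xB).
Qed.

(** The edge of a neighbour [v] has as [e v true] the element leaving [b] and as [e v false] the
    element entering; these are the data required for comparing line graphs. *)
Lemma neighbour_ends (b : basis_node M)
    (V := {v : basis_node M | basis_exchange_graph b v}) :
  exists e : V -> bool -> T,
  [/\ forall v w, (forall s, e v s = e w s) -> v = w,
      forall v w s s', e v s = e w s' -> s = s',
      forall v w, (exists s, e v s = e w s) <->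
        (v == w) || basis_exchange_graph (val v) (val w),
      forall (v : V) x, (x \in val (val v)) (+) (x \in val b)
        <-> exists s, x = e v s
    & forall x, x \in core_ground M <-> exists v s, x = e v s].
Proof.
have bM := valP b.
have /fin_all_exists[e eP] (v : V) : exists e : bool -> T,
    [/\ e true \in val b, e false \notin val b
      & val (val v) = e false |: (val b :\ e true)].
  have [x [y [xb yb vE]]] := basis_neighbourP bM (valP (val v)) (valP v).
  by exists (fun s => if s then x else y).
have memE v x : reflect (exists s, x = e v s)
    ((x \in val (val v)) (+) (x \in val b)).
  have [e1 e0 ->] := eP v; rewrite !inE.
  have [->|n0] := eqVneq x (e v false).
    by rewrite (negPf e0); apply: ReflectT; exists false.
  have [->|n1] := eqVneq x (e v true).
    by rewrite e1; apply: ReflectT; exists true.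
  rewrite addbb; apply: ReflectF => -[[] xE].
    by rewrite xE eqxx in n1.
  by rewrite xE eqxx in n0.
have sideE v s : (e v s \in val b) = s.
  by have [e1 e0 _] := eP v; case: s => //; apply: negPf.
exists e; split=> //.
- move=> v w vw; apply/val_inj/val_inj.
  by have [_ _ ->] := eP v; have [_ _ ->] := eP w; rewrite !vw.
- by move=> v w s s' vw; rewrite -(sideE v s) vw sideE.
- move=> v w; rewrite -!val_eqE /basis_exchange_graph /=.
  have [v1 v0 ->] := eP v; have [w1 w0 ->] := eP w.
  rewrite setU1D1_card1 //; split=> [[[] ->]|]; rewrite ?eqxx ?orbT //.
  by case/orP => /eqP; [exists true | exists false].
- by move=> v x; split=> /memE.
move=> x; split=> [xc|[v [s ->]]].
  have [A AM /andP[bA xA]] := core_neighbour bM xc.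
  pose v : V := Sub (node_of AM) bA.
  suff /memE[s xE] : (x \in val (val v)) (+) (x \in val b) by exists v, s.
  by move: xA => /=; case: (x \in A); case: (x \in val b).
apply: contraT => nc; have := introT (memE v (e v s)) (ex_intro _ s erefl).
by rewrite (notin_core (valP (val v)) bM nc) addbb.
Qed.

End Core.

(** Since [(+)] is membership in a symmetric difference, [f] carries the difference of [A] and [B],
    within [G], to that of [A'] and [B']. *)
Definition twisted (T T' : finType) (G : {set T}) (G' : {set T'})
    (f : {x | x \in G} -> {y | y \in G'}) (B A : {set T}) (B' A' : {set T'}) :=
  forall u, (val (f u) \in A') (+) (val (f u) \in B')
            = (val u \in A) (+) (val u \in B).

(** * From a graph isomorphism to a bijection of the cores *)

Section GraphIsomorphism.
Variables (T T' : finType) (M : matroid T) (M' : matroid T').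
Variable phi : basis_node M -> basis_node M'.
Hypothesis phi_bij : bijective phi.
Hypothesis phi_graph : forall x y,
  basis_exchange_graph (phi x) (phi y) = basis_exchange_graph x y.

Local Notation U := {x | x \in core_ground M}.
Local Notation U' := {y | y \in core_ground M'}.

Lemma neighbour_bijection (b : basis_node M) :
  exists2 f : U -> U', bijective f & forall v, basis_exchange_graph b v ->
    twisted f (val b) (val v) (val (phi b)) (val (phi v)).
Proof.
have phi_inj := bij_inj phi_bij.
have [e [e_inj e_side e_share e_mem e_core]] := neighbour_ends b.
have [e' [e'_inj e'_side e'_share e'_mem e'_core]] := neighbour_ends (phi b).
pose V := {v : basis_node M | basis_exchange_graph b v}.
pose V' := {v : basis_node M' | basis_exchange_graph (phi b) v}.
have psiP (v : V) : basis_exchange_graph (phi b) (phi (val v)).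
  by rewrite phi_graph; apply: valP.
pose psi (v : V) : V' := Sub (phi (val v)) (psiP v).
have psi_inj : injective psi.
  by move=> v w /(congr1 val)/= /phi_inj/val_inj.
have psi_surj v' : exists v, psi v = v'.
  have [phi' phiK phi'K] := phi_bij.
  have vP : basis_exchange_graph b (phi' (val v')).
    by rewrite -phi_graph phi'K; apply: valP.
  by exists (Sub (phi' (val v')) vP); apply: val_inj; rewrite /= phi'K.
have psi_share v w : (exists s, e v s = e w s)
    <-> (exists s, e' (psi v) s = e' (psi w) s).
  rewrite e_share e'_share (inj_eq psi_inj) /=.
  by rewrite phi_graph.
have [t tP] := line_graph_twist psi_inj e_inj e'_inj e_side e'_side psi_share.
(* A core element is an end of some edge [v]; its image is the end of [psi v] on the side given by
   [t]. The next claim shows independence of the chosen edge. *)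
have /fin_all_exists[f fP] (u : U) : exists y : U',
    exists v s, val u = e v s /\ val y = e' (psi v) (s (+) t v).
  have /e_core[v [s uE]] := valP u.
  have yc : e' (psi v) (s (+) t v) \in core_ground M'.
    by apply/e'_core; exists (psi v), (s (+) t v).
  by exists (exist (fun y => y \in core_ground M') _ yc), v, s.
have fE u v s : val u = e v s <-> val (f u) = e' (psi v) (s (+) t v).
  by have [w [s' [-> ->]]] := fP u; apply: tP.
exists f => [|v bv].
  apply: inj_card_bij.
    move=> u u' ff; apply: val_inj; have [v [s [uE fu]]] := fP u.
    by rewrite uE; apply/esym/fE; rewrite -ff.
  suff /fin_all_exists[g gK] (y : U') : exists u : U, f u = y.
    exact: leq_card (can_inj gK).
  have /e'_core[v' [s yE]] := valP y; have [v vE] := psi_surj v'.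
  have uc : e v (s (+) t v) \in core_ground M.
    by apply/e_core; exists v, (s (+) t v).
  exists (exist (fun x => x \in core_ground M) _ uc); apply: val_inj.
  rewrite yE -vE -[in RHS](addbK (t v) s).
  exact/fE.
have memE := e_mem (Sub v bv); have memE' := e'_mem (psi (Sub v bv)).
move=> u; apply/idP/idP => [/memE'|/memE] [s uE].
  by apply/memE; exists (s (+) t (Sub v bv)); apply/fE; rewrite addbK.
by apply/memE'; exists (s (+) t (Sub v bv)); apply/fE.
Qed.

Variables (f : U -> U') (b : basis_node M).
Local Notation tw v := (twisted f (val b) (val v) (val (phi b)) (val (phi v))).

(** The property propagated along the graph: it includes all neighbours, because a basis at distance
    two is recovered from two common neighbours and [c]. *)
Let good (c : basis_node M) :=
  tw c /\ (forall v : basis_node M, basis_exchange_graph c v -> tw v).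

Lemma good_neighbour (c v : basis_node M) :
  good c -> basis_exchange_graph c v -> good v.
Proof.
case=> twc twN cv; split=> [|a va]; first exact: twN.
have [<-//|nca] := eqVneq c a; have [ca|ca] := boolP (basis_exchange_graph c a).
  exact: twN.
have cardE (x y : basis_node M) : #|val x| = #|val y|.
  exact: card_basis (valP x) (valP y).
have cardE' (x y : basis_node M') : #|val x| = #|val y|.
  exact: card_basis (valP x) (valP y).
have symE (x y : basis_node M) :
    basis_exchange_graph x y = basis_exchange_graph y x.
  by rewrite /basis_exchange_graph !cardsD (cardE x y) setIC.
have adjD (x y : basis_node M) :
    basis_exchange_graph x y = (#|val y :\: val x| == 1).
  by rewrite symE.
have ac2 : #|val a :\: val c| = 2.
  apply/eqP; rewrite eqn_leq; apply/andP; split; last first.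
    rewrite ltn_neqAle eq_sym -adjD ca card_gt0 setD_eq0.
    apply: contraNN nca => /(basis_subset_eq (valP a) (valP c)).
    by move/val_inj->.
  rewrite adjD in cv; rewrite adjD in va; move/eqP: va; move/eqP: cv => cv av.
  rewrite -[2]/(1 + 1) -[X in X + _]av -cv.
  apply: leq_trans (leq_card_setU _ _); apply: subset_leq_card.
  apply/subsetP => x; rewrite !inE.
  by case: (x \in val v); case: (x \in val c); rewrite ?andbF ?orbF.
have /card_gt0P[z zac] : 0 < #|val a :\: val c| by rewrite ac2.
(* The two results [p], [q] of one symmetric exchange between [a] and [c] are common neighbours of
   [a] and [c], and they are not adjacent to each other. *)
have [y [yc Q1 P1 ya aQ]] := setD_basis_step (valP a) (valP c) zac.
have ac1 : #|(val a :\: val c) :\ z| = 1.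
  by move: ac2; rewrite (cardsD1 z) zac => -[].
pose p : basis_node M := node_of P1; pose q : basis_node M := node_of Q1.
have /setDP[za zc] := zac.
have ap : basis_exchange_graph p a.
  by rewrite symE; apply/(basis_neighbourP (valP a) P1); exists z, y.
have cq : basis_exchange_graph c q.
  by apply/(basis_neighbourP (valP c) Q1); exists y, z.
have aq : basis_exchange_graph q a by rewrite adjD /= aQ ac1.
have cp : basis_exchange_graph c p.
  rewrite adjD -ac1; apply/eqP/eq_card => x; rewrite /= !inE.
  by have [->|_] := eqVneq x y; rewrite ?yc ?andbF //= andbCA.
have pq : #|val p :\: val q| = 2.
  have -> : val p :\: val q = y |: ((val a :\: val c) :\ z).
    apply/setP => x; rewrite /= !inE; have [->|_] := eqVneq x y.
      by case: eqP zc => [<-|_]; rewrite ?yc.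
    by case: (x == z); rewrite //= andbF.
  by rewrite cardsU1 ac1 !inE yc !andbF.
have ayx x : (x \in val a) = (x \in val p) (+) (x \in val q) (+) (x \in val c).
  apply: square_xor; rewrite ?(inj_eq val_inj) ?pq //.
  by apply: contra_eq_neq pq => ->; rewrite setDv cards0.
(* The hypotheses of [square_xor] only concern equality, adjacency and equal sizes, so they hold for
   the images as well. *)
have ayx' x : (x \in val (phi a))
    = (x \in val (phi p)) (+) (x \in val (phi q)) (+) (x \in val (phi c)).
  have phi_inj := bij_inj phi_bij.
  have npq : ~~ basis_exchange_graph p q by rewrite /basis_exchange_graph pq.
  apply: square_xor; rewrite ?(inj_eq val_inj) ?(inj_eq phi_inj) //;
    rewrite -/(basis_exchange_graph _ _) ?phi_graph //.
  by apply: contra_eq_neq pq => ->; rewrite setDv cards0.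
move=> u; rewrite ayx ayx'.
have := twc u; have := twN p cp u; have := twN q cq u.
by do 4!case: (_ \in _); do 4!case: (_ \in _).
Qed.

Lemma good_twisted (c v : basis_node M) : good c -> tw v.
Proof.
have [n] := ubnP #|val v :\: val c|; elim: n c => // n IHn c.
rewrite ltnS => lec gc; have [vc0|[z zvc]] := set_0Vmem (val v :\: val c).
  suff <- : c = v by case: gc.
  apply/val_inj/esym/(basis_subset_eq (valP v) (valP c)).
  by rewrite -setD_eq0 vc0.
have [y [yc Q1 _ yv vQ]] := setD_basis_step (valP v) (valP c) zvc.
have /setDP[zv zc] := zvc.
pose q : basis_node M := node_of Q1.
apply: (IHn q); last first.
  apply: good_neighbour gc _.
  by apply/(basis_neighbourP (valP c) Q1); exists y, z.
by apply: leq_trans lec; rewrite /= vQ [ltnRHS](cardsD1 z) zvc.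
Qed.

End GraphIsomorphism.

Lemma graph_isomorphic_twisted (T T' : finType)
    (M : matroid T) (M' : matroid T') :
    graph_isomorphic (@basis_exchange_graph T M)
                     (@basis_exchange_graph T' M') ->
  exists (f : {x | x \in core_ground M} -> {y | y \in core_ground M'}) B B',
  [/\ bijective f, B \in bases M, B' \in bases M',
      forall A, A \in bases M ->
        exists2 A', A' \in bases M' & twisted f B A B' A'
    & forall A', A' \in bases M' ->
        exists2 A, A \in bases M & twisted f B A B' A'].
Proof.
case=> phi phi_bij phi_graph; have /set0Pn[B BM] := bases_neq0 M.
pose b : basis_node M := node_of BM.
have [f f_bij fP] := neighbour_bijection phi_bij phi_graph b.
(* The base node [b] is good: its own differences are empty, and [f] was built from its
   neighbours. *)
have tw v : twisted f B (val v) (val (phi b)) (val (phi v)).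
  apply: (good_twisted phi_bij phi_graph (b := b) (c := b)).
  by split=> // u; rewrite !addbb.
exists f, B, (val (phi b)); split=> // [|A AM|A' A'M].
- exact: valP.
- by exists (val (phi (node_of AM))); [apply: valP | apply: (tw (node_of AM))].
have [phi' phiK phi'K] := phi_bij.
exists (val (phi' (node_of A'M))); first exact: valP.
by have := tw (phi' (node_of A'M)); rewrite phi'K.
Qed.

(** * Transfer of bases and separators along the bijection *)

Section Isomorphism.
Variables (T T' : finType) (G : {set T}) (G' : {set T'}).
Variable f : {x | x \in G} -> {y | y \in G'}.
Hypothesis f_bij : bijective f.

Lemma isomorphic_restr (N : matroid T) (N' : matroid T') :
    ground N \subset G -> ground N' \subset G' ->
    (forall u, (val (f u) \in ground N') = (val u \in ground N)) ->
    (forall A, A \in bases N -> exists2 A', A' \in bases N' &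
       forall u, val u \in ground N -> (val (f u) \in A') = (val u \in A)) ->
    (forall A', A' \in bases N' -> exists2 A, A \in bases N &
       forall u, val u \in ground N -> (val (f u) \in A') = (val u \in A)) ->
  isomorphic N N'.
Proof.
move=> sG sG' fG fwd bwd; have [g fK gK] := f_bij.
pose up (w : {x | x \in ground N}) : {x | x \in G} :=
  exist (fun x => x \in G) (val w) (subsetP sG _ (valP w)).
have hP w : val (f (up w)) \in ground N' by rewrite fG; apply: (valP w).
pose h w : {y | y \in ground N'} := exist (fun y => y \in ground N') _ (hP w).
have h_inj : injective h.
  move=> w w' /(congr1 val)/= /val_inj/(can_inj fK)/(congr1 val)/= ww.
  exact: val_inj.
have h_surj z : exists w, h w = z.
  pose y : {y | y \in G'} :=
    exist (fun y => y \in G') (val z) (subsetP sG' _ (valP z)).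
  have wP : val (g y) \in ground N by rewrite -fG gK; apply: (valP z).
  exists (exist (fun x => x \in ground N) _ wP); apply: val_inj => /=.
  by rewrite (_ : up _ = g y) ?gK //; apply: val_inj.
exists h; split.
  have /fin_all_exists[k hK] := h_surj.
  by exists k => // w; apply: h_inj; rewrite hK.
move=> B.
have valB (D : {set {x | x \in ground N}}) w : (val w \in val @: D) = (w \in D).
  by rewrite mem_imset //; apply: val_inj.
have valB' (D : {set {x | x \in ground N'}}) w :
    (val w \in val @: D) = (w \in D).
  by rewrite mem_imset //; apply: val_inj.
have eqN (C D : {set T}) : C \subset ground N -> D \subset ground N ->
    (forall w : {x | x \in ground N}, (val w \in C) = (val w \in D)) -> C = D.
  move=> sC sD CD; apply/setP => x; have [xN|xN] := boolP (x \in ground N).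
    exact: CD (exist (fun x => x \in ground N) x xN).
  by rewrite (contraNF (subsetP sC x) xN) (contraNF (subsetP sD x) xN).
have eqN' (C D : {set T'}) : C \subset ground N' -> D \subset ground N' ->
    (forall w, (val (h w) \in C) = (val (h w) \in D)) -> C = D.
  move=> sC sD CD; apply/setP => x; have [xN|xN] := boolP (x \in ground N').
    have [w /(congr1 val)/= <-] := h_surj (exist (fun x => x \in ground N') x xN).
    exact: CD.
  by rewrite (contraNF (subsetP sC x) xN) (contraNF (subsetP sD x) xN).
have sB : val @: B \subset ground N.
  by apply/subsetP => _ /imsetP[w _ ->]; apply: (valP w).
have shB : val @: (h @: B) \subset ground N'.
  by apply/subsetP => _ /imsetP[w _ ->]; apply: (valP w).
have hB w : (val (h w) \in val @: (h @: B)) = (val w \in val @: B).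
  by rewrite valB valB' mem_imset.
apply/idP/idP => [/fwd[A' A'N AA]|/bwd[A AN AA]].
  rewrite (eqN' (val @: (h @: B)) A') ?(bases_sub_ground A'N) // => w.
  by rewrite hB; apply/esym/(AA (up w))/(valP w).
rewrite (eqN (val @: B) A) ?(bases_sub_ground AN) // => w.
by rewrite -hB; apply/(AA (up w))/(valP w).
Qed.

Variables (K : matroid T) (K' : matroid T') (B : {set T}) (B' : {set T'}).
Hypotheses (GK : ground K = G) (GK' : ground K' = G').
Hypotheses (BK : B \in bases K) (BK' : B' \in bases K').
Hypothesis fwd : forall A, A \in bases K ->
  exists2 A', A' \in bases K' & twisted f B A B' A'.
Hypothesis bwd : forall A', A' \in bases K' ->
  exists2 A, A \in bases K & twisted f B A B' A'.

(** Mixing commutes with taking the symmetric difference with a fixed set, so the image of the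
    mixture of [A] and [C] is the mixture of [A'] and [C']. *)
Lemma separator_transfer (S : {set T}) (S' : {set T'}) :
    (forall u, (val (f u) \in S') = (val u \in S)) ->
  separator K S -> separator K' S'.
Proof.
move=> SS sS A' C' A'K C'K; have [A AK AA] := bwd A'K.
have [C CK CC] := bwd C'K; have [D' D'K DD] := fwd (sS _ _ AK CK).
rewrite (_ : _ :|: _ = D') //; apply/setP => y.
have [yG|yG] := boolP (y \in G').
  have [g _ gK] := f_bij; pose u := g (exist (fun y => y \in G') y yG).
  have <- : val (f u) = y by rewrite gK.
  have := DD u; have := AA u; have := CC u; rewrite !inE SS.
  case: (val u \in S); rewrite ?andbT ?andbF ?orbF /=.
    by move=> _ <- /addIb.
  by move=> <- _ /addIb.
rewrite -GK' in yG.
rewrite (contraNF (subsetP (bases_sub_ground D'K) y) yG) !inE.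
rewrite (contraNF (subsetP (bases_sub_ground A'K) y) yG).
by rewrite (contraNF (subsetP (bases_sub_ground C'K) y) yG) andbF.
Qed.

(** Let [A'] correspond to [A]. At [u] in this set [X], [A] and [A'] both contain or both omit the
    matching elements; elsewhere exactly one contains its element. Hence [#|A| + #|A'|] is twice
    [#|A :&: X|] plus a constant. The left side is constant, so [separator_card] applies. *)
Lemma separator_untwisted :
  separator K
    [set val u | u : {x | x \in G} & (val (f u) \in B') == (val u \in B)].
Proof.
set X := (X in separator _ X).
have inX u : (val u \in X) = ((val (f u) \in B') == (val u \in B)).
  by rewrite mem_imset ?inE //; apply: val_inj.
apply: (separator_card (B := B)) => A AK; have [A' A'K AA] := fwd AK.
have cA := card_basis AK BK; have cA' := card_basis A'K BK'.
have sG D : D \in bases K -> D \subset G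
  by rewrite -GK; apply: bases_sub_ground.
have sG' D : D \in bases K' -> D \subset G'
  by rewrite -GK'; apply: bases_sub_ground.
have [g fK gK] := f_bij.
have sumE D D' : D \in bases K -> D' \in bases K' -> #|D| + #|D'| =
    \sum_(u | val u \in X) ((val u \in D) + (val (f u) \in D')) +
    \sum_(u | val u \notin X) ((val u \in D) + (val (f u) \in D')).
  move=> DK D'K; rewrite (sum_mem_card (sG _ DK)) (sum_mem_card (sG' _ D'K)).
  rewrite [X in _ + X](reindex f) /=; last exact: onW_bij.
  by rewrite -big_split /= (bigID (fun u => val u \in X)).
have sumX D D' : D \in bases K -> twisted f B D B' D' ->
    \sum_(u | val u \in X) ((val u \in D) + (val (f u) \in D'))
    = (#|D :&: X|).*2.
  move=> DK DD; rewrite (sum_mem_card (P := G)); last first.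
    exact: subset_trans (subsetIl _ _) (sG _ DK).
  rewrite -mul2n big_distrr /= [LHS]big_mkcond; apply: eq_bigr => u _.
  rewrite inE; have := DD u; have := inX u.
  case: (val u \in X) => [/esym/eqP->|_ _].
    by move/addIb->; case: (_ \in D).
  by rewrite andbF.
have sumX' D D' : twisted f B D B' D' ->
    \sum_(u | val u \notin X) ((val u \in D) + (val (f u) \in D'))
    = \sum_(u : {x | x \in G} | val u \notin X) 1.
  move=> DD; apply: eq_bigr => u; rewrite inX; have := DD u.
  by do 4!case: (_ \in _).
have BB : twisted f B B B' B' by move=> u; rewrite !addbb.
apply: double_inj; rewrite -(sumX _ _ AK AA) -(sumX _ _ BK BB).
have := sumE _ _ AK A'K; rewrite cA cA' (sumE _ _ BK BK').
rewrite (sumX' _ _ AA) (sumX' _ _ BB).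
by move/addIn.
Qed.

End Isomorphism.

(** * Matching the connected summands *)

Section Summands.
Variables (T T' : finType) (K : matroid T) (K' : matroid T').
Variable f : {x | x \in ground K} -> {y | y \in ground K'}.
Variables (B : {set T}) (B' : {set T'}).
Hypotheses (f_bij : bijective f) (BK : B \in bases K) (BK' : B' \in bases K').
Hypothesis fwd : forall A, A \in bases K ->
  exists2 A', A' \in bases K' & twisted f B A B' A'.
Hypothesis bwd : forall A', A' \in bases K' ->
  exists2 A, A \in bases K & twisted f B A B' A'.
Variables (k k' : nat) (N : 'I_k -> matroid T) (N' : 'I_k' -> matroid T').
Hypotheses (hN : are_connected_summands K N)
           (hN' : are_connected_summands K' N').

Lemma summand_image i :
  exists j, forall u, (val (f u) \in ground (N' j)) = (val u \in ground (N i)).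
Proof.
have [sumN cN] := hN; have [sumN' cN'] := hN'.
have [g fK gK] := f_bij.
have [/set0Pn[x xi] conn_i] := cN i.
pose u : {x | x \in ground K} :=
  exist (fun x => x \in ground K) x (subsetP (ground_summand sumN i) _ xi).
(* The summand containing the image of one point of [N i] is the right one: each ground set, carried
   over by [f] or its inverse, is a separator meeting the other, so connectedness gives both
   inclusions. *)
have [j fuj] : exists j, val (f u) \in ground (N' j).
  have [_ /setP/(_ (val (f u))) gE _] := sumN'; move: gE.
  by rewrite (valP (f u)) => /esym/bigcupP[j _ fuj]; exists j.
have [_ conn_j] := cN' j.
exists j.
pose Si := [set val (f v) | v : {x | x \in ground K} & val v \in ground (N i)].
have inSi v : (val (f v) \in Si) = (val v \in ground (N i)).
  rewrite (mem_imset (f := val \o f)) ?inE //.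
  exact: inj_comp val_inj (bij_inj f_bij).
have sepi : separator K' Si.
  apply: (separator_transfer f_bij erefl fwd bwd inSi).
  exact: separator_summand.
pose Sj := [set val v | v : {x | x \in ground K} & val (f v) \in ground (N' j)].
have inSj v : (val v \in Sj) = (val (f v) \in ground (N' j)).
  by rewrite mem_imset ?inE //; apply: val_inj.
have sepj : separator K Sj.
  have g_bij : bijective g by exists f.
  apply: (separator_transfer (K := K') (B := B') (B' := B) g_bij erefl _ _
    (S := ground (N' j))).
  - by move=> A /bwd[A' A'K AA]; exists A' => // y; rewrite -(AA (g y)) gK.
  - by move=> A /fwd[A' A'K AA]; exists A' => // y; rewrite -(AA (g y)) gK.
  - by move=> y; rewrite inSj gK.
  exact: separator_summand.
have [sji|/disjointFr/(_ fuj)] :=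
  connected_separator conn_j (separator_restr_summand sumN' (i := j) sepi);
  last first.
  by rewrite inSi xi.
have [sij|/disjointFr/(_ xi)] :=
  connected_separator conn_i (separator_restr_summand sumN (i := i) sepj);
  last first.
  by rewrite (inSj u) fuj.
move=> v; apply/idP/idP => [/(subsetP sji)|/(subsetP sij)].
  by rewrite inSi.
by rewrite inSj.
Qed.

(** By connectedness, [ground (N i)] lies inside the separator [X] or is disjoint from it. In the
    first case [f] preserves membership in bases; in the second it complements it, which gives the
    dual. *)
Lemma summand_isomorphic i j :
    (forall u, (val (f u) \in ground (N' j)) = (val u \in ground (N i))) ->
  isomorphic (N i) (N' j) \/ isomorphic (dual_matroid (N i)) (N' j).
Proof.
move=> ij; have [sumN cN] := hN; have [sumN' cN'] := hN'.
have sepX := separator_untwisted f_bij erefl erefl BK BK' fwd.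
set X := (X in separator _ X) in sepX.
have inX u : (val u \in X) = ((val (f u) \in B') == (val u \in B)).
  by rewrite mem_imset ?inE //; apply: val_inj.
have [_ conn_i] := cN i; have sG := ground_summand sumN i.
have sG' := ground_summand sumN' j.
have [sX|dX] := connected_separator conn_i (separator_restr_summand sumN sepX).
  have eqA A A' u : twisted f B A B' A' -> val u \in ground (N i) ->
      (val (f u) \in A' :&: ground (N' j)) = (val u \in A :&: ground (N i)).
    move=> AA ui; rewrite !inE ij ui !andbT; have := AA u.
    by have := subsetP sX _ ui; rewrite inX => /eqP-> /addIb.
  left; apply: (isomorphic_restr f_bij) => //.
    move=> A; rewrite (bases_summand sumN) => /imsetP[A0 /fwd[A' A'K AA] ->].
    exists (A' :&: ground (N' j)); last by move=> u; apply: eqA.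
    by rewrite (bases_summand sumN'); apply: imset_f.
  move=> A'; rewrite (bases_summand sumN') => /imsetP[A0 /bwd[A AK AA] ->].
  exists (A :&: ground (N i)); last by move=> u; apply: eqA.
  by rewrite (bases_summand sumN); apply: imset_f.
have eqA A A' u : twisted f B A B' A' -> val u \in ground (N i) ->
    (val (f u) \in A' :&: ground (N' j))
    = (val u \in ground (N i) :\: (A :&: ground (N i))).
  move=> AA ui; rewrite !inE ij ui !andbT; have := AA u.
  have /negbT := disjointFr dX ui; rewrite inX.
  by do 4!case: (_ \in _).
right; apply: (isomorphic_restr f_bij) => //=.
  move=> _ /imsetP[A + ->].
  rewrite (bases_summand sumN) => /imsetP[A0 /fwd[A' A'K AA] ->].
  exists (A' :&: ground (N' j)); last by move=> u; apply: eqA.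
  by rewrite (bases_summand sumN'); apply: imset_f.
move=> A'; rewrite (bases_summand sumN') => /imsetP[A0 /bwd[A AK AA] ->].
exists (ground (N i) :\: (A :&: ground (N i))); last by move=> u; apply: eqA.
by apply/imset_f; rewrite (bases_summand sumN); apply: imset_f.
Qed.

Lemma connected_summands_isomorphic :
  exists (e : k = k') (s : {perm 'I_k}), forall i : 'I_k,
    isomorphic (N i) (N' (cast_ord e (s i))) \/
    isomorphic (dual_matroid (N i)) (N' (cast_ord e (s i))).
Proof.
have [sumN cN] := hN; have [sumN' cN'] := hN'.
have [g fK gK] := f_bij.
have /fin_all_exists[s sP] := summand_image.
have s_inj : injective s.
  move=> i i' ss; have [/set0Pn[x xi] _] := cN i.
  have xK := subsetP (ground_summand sumN i) _ xi.
  apply: (summand_inj sumN xi).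
  rewrite -[x]/(val (exist (fun x => x \in ground K) x xK)).
  by rewrite -sP -ss sP.
have s_surj j : exists i, s i = j.
  have [/set0Pn[y yj] _] := cN' j.
  have yK := subsetP (ground_summand sumN' j) _ yj.
  pose u := g (exist (fun y => y \in ground K') y yK).
  have uy : val (f u) = y by rewrite gK.
  have [_ /setP/(_ (val u)) gE _] := sumN; move: gE.
  rewrite (valP u) => /esym/bigcupP[i _ ui].
  by exists i; apply: (summand_inj sumN' (x := y)) => //; rewrite -uy sP.
have [t tK] := fin_all_exists s_surj.
have e : k = k'.
  rewrite -(card_ord k) -(card_ord k'); apply: (@bij_eq_card _ _ s).
  by exists t => // i; apply: s_inj; rewrite tK.
(* A permutation needs values in ['I_k], so [s] is followed by the cast back from ['I_k'], which
   [cast_ord e] undoes. *)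
exists e, (perm (inj_comp (@cast_ord_inj _ _ (esym e)) s_inj)) => i.
by rewrite permE /= cast_ordKV; apply/summand_isomorphic/sP.
Qed.

End Summands.

(** * Passing to the matroids without loops and coloops *)

Lemma mem_core_basis (T : finType) (M : matroid T) (A : {set T}) x :
  x \in core_ground M -> (x \in A :\: coloops M) = (x \in A).
Proof.
by rewrite /core_ground !in_setD in_setU negb_or => /andP[/andP[_ ->]].
Qed.

Theorem theorem13 (T T' : finType) (M : matroid T) (M' : matroid T')
    (hG : graph_isomorphic (@basis_exchange_graph T M)
                           (@basis_exchange_graph T' M'))
    (k k' : nat) (N : 'I_k -> matroid T) (N' : 'I_k' -> matroid T')
    (hN : are_connected_summands (remove_loops_coloops M) N)
    (hN' : are_connected_summands (remove_loops_coloops M') N') :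
  exists (e : k = k') (s : {perm 'I_k}), forall i : 'I_k,
    isomorphic (N i) (N' (cast_ord e (s i))) \/
    isomorphic (dual_matroid (N i)) (N' (cast_ord e (s i))).
Proof.
have [f [B [B' [f_bij BM BM' fwd bwd]]]] := graph_isomorphic_twisted hG.
(* The map [f] lives on the cores, where deleting coloops from a basis does not affect
   membership. *)
have twK A A' : twisted f B A B' A' ->
    twisted f (B :\: coloops M) (A :\: coloops M)
              (B' :\: coloops M') (A' :\: coloops M').
  by move=> AA u; rewrite !(mem_core_basis _ (valP _)).
apply: (connected_summands_isomorphic (K := remove_loops_coloops M)
  (K' := remove_loops_coloops M') f_bij (B := B :\: coloops M)
  (B' := B' :\: coloops M')) => //; try exact: imset_f.
  move=> _ /imsetP[A /fwd[A' A'M /twK AA] ->].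
  by exists (A' :\: coloops M') => //; apply: imset_f.
move=> _ /imsetP[A' /bwd[A AM /twK AA] ->].
by exists (A :\: coloops M) => //; apply: imset_f.
Qed.
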